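(* Consider the symmetric dynamic monopolistic competition model with sluggish entry and exit ($dn/dt = s\cdot$(total industry profit), $s>0$, discount rate $\rho>0$) under general inverse demand and cost functions, with the notation and standing assumptions given in the context. Let $(\tilde x,\tilde n)$ be the static equilibrium of monopolistic competition, i.e. $\tilde x>0$, $\tilde n>1$, $$p(\tilde x,\tilde n)\tilde x-c(\tilde x)=0,\qquad p(\tilde x,\tilde n)+p_1(\tilde x,\tilde n)\tilde x-c'(\tilde x)=0,$$ and let $(x^*,n^* )$ (with costate value $\lambda^*$) be the symmetric steady state of the open-loop solution. Then the number of firms at the steady state of the open-loop solution is smaller than the number of firms at the static equilibrium: $$n^*<\tilde n.$$
   Context: Model. At each time $t\ge 0$ there are $n(t)$ firms producing differentiated goods; firm $i$ chooses output $x_i(t)$, faces the inverse demand function $p_i(x_1,\dots,x_n)$ (symmetric across firms) and has cost $c(x_i)$, with $c'>0$, the cost $c$ including any fixed cost. Firm $i$ maximizes $\int_0^\infty e^{-\rho t}[x_ip_i-c(x_i)]\,dt$ subject to $\frac{dn}{dt}=s\left[\sum_{j=1}^n x_jp_j-\sum_{j=1}^n c(x_j)\right]$, where $\rho>0$ and $s>0$. The number of firms $n$ is treated as a continuous real variable. Functions are as smooth as needed. Notation at symmetric points. When all outputs equal $x$ and there are $n$ firms, write $p=p(x,n)$ for the price $p_i(x,\dots,x)$; $p_1=\partial p_i/\partial x_i$; $p_2=\partial p_i/\partial x_j$ ($j\ne i$); $p_{11}=\partial^2p_i/\partial x_i^2$; $p_{12}=\partial^2p_i/\partial x_i\partial x_j$;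 $p_{22}=\partial^2p_i/\partial x_j^2$; $p_{23}=\partial^2p_i/\partial x_j\partial x_k$ ($i,j,k$ distinct), all evaluated at the symmetric point and regarded as functions of $(x,n)$. Differentiation in $n$ follows the convention $\partial p/\partial n=p_2x$ (an additional firm adds one more output $x$), and $\partial p/\partial x=p_1+(n-1)p_2$. Standing assumptions: $p_1<0$, $p_2<0$, $|p_2|<|p_1|$; $p_2+p_{12}x<0$ (strategic substitutes); $p_2+p_{23}x<0$; $|p_2+p_{12}x|\ge|p_2+p_{23}x|$; $p-c'(x)>0$. Along the free entry locus $p(x,n)x-c(x)=0$ (over the range of outputs containing the static equilibrium and steady-state outputs) it is assumed that $p+p_1x+(n-1)p_2x-c'(x)<0$, so that along this locus $n$ is a function of $x$ with $\frac{dn}{dx}=-\frac{p+p_1x+(n-1)p_2x-c'(x)}{p_2x^2}<0$. At the steady state of dynamic solutions it is assumed that $p+\frac{(p_1-p_2)[p_1+(n-1)p_2]}{p_1+(n-2)p_2}x-c'(x)>0$. Open-loop steady state. With current-value Hamiltonian $\hat{\mathcal H}_i=x_ip_i-c(x_i)+\lambda_i s\left[\sum_jx_jp_j-\sum_jc(x_j)\right]$, the open-loop conditions are $\partial\hat{\mathcal H}_i/\partial x_i=0$, $\partial^2\hat{\mathcal H}_i/\partial x_i^2<0$ and $-\partial\hat{\mathcal H}_i/\partial n=\dot\lambda_i-\rho\lambda_i$. A symmetric steady state is a triple $(x^*,n^*,\lambda^* )$, $x^*>0$, $n^*>1$, satisfying, with all functions evaluated at $(x^*,n^* )$: (i) free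 entry: $p\,x^*-c(x^* )=0$; (ii) first order condition: $p+p_1x^*-c'(x^* )+\lambda^*s\left[p+p_1x^*+(n^*-1)p_2x^*-c'(x^* )\right]=0$; (iii) adjoint condition: $-p_2(x^* )^2-\lambda^*n^*s\,p_2(x^* )^2=-\rho\lambda^*$; (iv) second order condition: $2p_1+p_{11}x^*-c''(x^* )+\lambda^*s\left[2p_1+p_{11}x^*+(n^*-1)p_{22}x^*-c''(x^* )\right]<0$. The existence and uniqueness of the static equilibrium and of the steady state are presumed.
   Formalization: The static equilibrium is also assumed to satisfy the strict second-order condition 2p_1 + p_11 x − c'' < 0 at (x̃, ñ); without it the two displayed equations may describe a profit minimum, and then the claim can fail. *)

(* Defs.v *)
From Stdlib Require Import Reals.
From Coquelicot Require Import Coquelicot.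
Open Scope R_scope.

(** [P y z w x n] is the price of a firm's good when there are [n] firms, the
    firm itself produces [y], two given rivals produce [z] and [w], and each of
    the remaining [n - 3] firms produces [x].  These are the only output
    profiles needed to form first and second partial derivatives at symmetric
    points.  As [n] is a real number, the dependence on [x] and [n] is only
    constrained by [entry_convention] below, and for [n < 3] the number [n - 3]
    of remaining firms is formal. *)
Definition demand := R -> R -> R -> R -> R -> R.

(** Partial derivatives with respect to the firm's own output and to the
    outputs of the two given rivals. *)
Definition D1 (P : demand) : demand :=
  fun y z w x n => Derive (fun t => P t z w x n) y.
Definition D2 (P : demand) : demand :=
  fun y z w x n => Derive (fun t => P y t w x n) z.
Definition D3 (P : demand) : demand :=
  fun y z w x n => Derive (fun t => P y z t x n) w.

Definition at_sym (P : demand) (x n : R) : R := P x x x x n.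

Definition price (P : demand) := at_sym P.
Definition p1 (P : demand) := at_sym (D1 P).
Definition p2 (P : demand) := at_sym (D2 P).
Definition p11 (P : demand) := at_sym (D1 (D1 P)).
Definition p12 (P : demand) := at_sym (D2 (D1 P)).
Definition p22 (P : demand) := at_sym (D2 (D2 P)).
Definition p23 (P : demand) := at_sym (D3 (D2 P)).

Definition partially_derivable (P : demand) : Prop :=
  forall y z w x n, 0 < y -> 0 < z -> 0 < w -> 0 < x -> 1 < n ->
    ex_derive (fun t => P t z w x n) y /\
    ex_derive (fun t => P y t w x n) z /\
    ex_derive (fun t => P y z t x n) w.

Definition continuous_sym (f : R -> R -> R) : Prop :=
  forall x n, 0 < x -> 1 < n -> continuity_2d_pt f x n.

Record smooth_demand (P : demand) : Prop := {
  derivable_P : partially_derivable P;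
  derivable_D1 : partially_derivable (D1 P);
  derivable_D2 : partially_derivable (D2 P);
  derivable_D3 : partially_derivable (D3 P);
  cont_price : continuous_sym (price P);
  cont_p1 : continuous_sym (p1 P);
  cont_p2 : continuous_sym (p2 P);
  cont_p11 : continuous_sym (p11 P);
  cont_p12 : continuous_sym (p12 P);
  cont_p22 : continuous_sym (p22 P);
  cont_p23 : continuous_sym (p23 P)
}.

Definition symmetric_demand (P : demand) : Prop :=
  forall y z w x n, P y z w x n = P y w z x n.

(** An additional firm adds one more output [x]; a change of the common output
    moves the firm's own output and those of its [n - 1] rivals.  The rule is
    imposed on [p] and on [p1].  It is not imposed on [p2]: equality of mixed
    derivatives of [p] would then force [p22 = p23]. *)
Record entry_convention (P : demand) : Prop := {
  price_n : forall x n, 0 < x -> 1 < n ->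
    is_derive (fun m => price P x m) n (p2 P x n * x);
  price_x : forall x n, 0 < x -> 1 < n ->
    is_derive (fun t => price P t n) x (p1 P x n + (n - 1) * p2 P x n);
  p1_n : forall x n, 0 < x -> 1 < n ->
    is_derive (fun m => p1 P x m) n (p12 P x n * x);
  p1_x : forall x n, 0 < x -> 1 < n ->
    is_derive (fun t => p1 P t n) x (p11 P x n + (n - 1) * p12 P x n)
}.

Definition cost1 (c : R -> R) : R -> R := Derive c.
Definition cost2 (c : R -> R) : R -> R := Derive (Derive c).

Record smooth_cost (c : R -> R) : Prop := {
  derivable_c : forall x, 0 < x -> ex_derive c x;
  derivable_c1 : forall x, 0 < x -> ex_derive (cost1 c) x;
  cont_c2 : forall x, 0 < x -> continuous (cost2 c) x
}.

Definition free_entry (P : demand) (c : R -> R) (x n : R) : Prop :=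
  price P x n * x - c x = 0.

(** [p + p1 x - c'], the static marginal profit. *)
Definition static_marginal (P : demand) (c : R -> R) (x n : R) : R :=
  price P x n + p1 P x n * x - cost1 c x.

(** [p + p1 x + (n - 1) p2 x - c'], the effect of a firm's output on industry
    profit, which is also the [x]-derivative of [p x - c]. *)
Definition industry_marginal (P : demand) (c : R -> R) (x n : R) : R :=
  price P x n + p1 P x n * x + (n - 1) * p2 P x n * x - cost1 c x.

Record standing (P : demand) (c : R -> R) (x n : R) : Prop := {
  p1_neg : p1 P x n < 0;
  p2_neg : p2 P x n < 0;
  own_dominates : Rabs (p2 P x n) < Rabs (p1 P x n);
  strategic_substitutes : p2 P x n + p12 P x n * x < 0;
  rival_substitutes : p2 P x n + p23 P x n * x < 0;
  substitutes_order :
    Rabs (p2 P x n + p12 P x n * x) >= Rabs (p2 P x n + p23 P x n * x);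
  price_above_marginal_cost : price P x n - cost1 c x > 0
}.

Record static_equilibrium (P : demand) (c : R -> R) (x n : R) : Prop := {
  se_x : 0 < x;
  se_n : 1 < n;
  se_entry : free_entry P c x n;
  se_foc : static_marginal P c x n = 0
}.

Definition static_soc (P : demand) (c : R -> R) (x n : R) : Prop :=
  2 * p1 P x n + p11 P x n * x - cost2 c x < 0.

Record open_loop_steady_state (P : demand) (c : R -> R) (s rho : R)
    (x n lam : R) : Prop := {
  ol_x : 0 < x;
  ol_n : 1 < n;
  ol_entry : free_entry P c x n;
  ol_foc :
    static_marginal P c x n + lam * s * industry_marginal P c x n = 0;
  ol_adjoint :
    - p2 P x n * x ^ 2 - lam * n * s * p2 P x n * x ^ 2 = - rho * lam;
  ol_soc :
    2 * p1 P x n + p11 P x n * x - cost2 c x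
    + lam * s * (2 * p1 P x n + p11 P x n * x + (n - 1) * p22 P x n * x
                 - cost2 c x) < 0
}.

Definition dynamic_condition (P : demand) (c : R -> R) (x n : R) : Prop :=
  price P x n
  + (p1 P x n - p2 P x n) * (p1 P x n + (n - 1) * p2 P x n)
    / (p1 P x n + (n - 2) * p2 P x n) * x
  - cost1 c x > 0.

(* Main.v *)
Require Import Defs.
From Stdlib Require Import Reals Lra IndefiniteDescription.
From Coquelicot Require Import Coquelicot.
Open Scope R_scope.

(** Suppose [nt <= ns].  The adjoint condition makes the costate negative, so
    the first order condition, with [industry_marginal < 0], forces
    [static_marginal < 0] at the steady state
    ([open_loop_costate_neg]).

    On the free entry locus profit has a negative derivative both in [x]
    (by [industry_marginal < 0]) and in [n] (by [p2 < 0]), and a function whose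
    derivative is negative at each of its zeros crosses zero once, downwards
    ([stays_negative]).  Hence the locus slopes downwards in the strong sense
    that two of its points are always ordered oppositely in [x] and [n], and
    [nt <= ns] gives [xs < xt] ([more_firms_less_output]).  The same crossings
    show that nothing of the locus is missing between the two points: there it
    is the graph of a continuous function [N] ([decreasing_zero_curve]).

    Finally, follow the static marginal profit along this graph.  At
    [(xt, nt)] it vanishes and its slope is exactly the left side of the static
    second order condition, because the two effects of the other firms, through
    their outputs and through their number, cancel
    ([static_marginal_slope_on_locus]).  So it is positive just to the left of
    [xt] while negative at [xs], and it vanishes somewhere strictly before
    [xt] ([static_equilibrium_between]).  That is a second static equilibrium,
    contrary to uniqueness. *)

(** * Functions that cross zero only downwards *)

Lemma derivative_neg_local_sign (f : R -> R) (x d : R) :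
  is_derive f x d -> d < 0 -> f x = 0 ->
  exists delta : posreal, forall y, Rabs (y - x) < delta ->
    (x < y -> f y < 0) /\ (y < x -> 0 < f y).
Proof.
  intros Hd Hneg H0. apply is_derive_Reals in Hd.
  destruct (Hd (- d) ltac:(lra)) as [delta Hdelta].
  exists delta. intros y Hy.
  assert (Hq : y <> x -> (f y - f x) / (y - x) < 0).
  { intros Hne. specialize (Hdelta (y - x) ltac:(lra) Hy).
    replace (x + (y - x)) with y in Hdelta by ring.
    apply Rabs_def2 in Hdelta. lra. }
  assert (Hm : y <> x -> f y = (f y - f x) / (y - x) * (y - x)).
  { intros Hne. rewrite H0. field. lra. }
  split; intros Hlt; specialize (Hq ltac:(lra)); specialize (Hm ltac:(lra)); nra.
Qed.

(** With [z] the supremum of the points of [[a, b']] where [f <= 0], continuity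
    gives [f z <= 0], and if [z < b'] then [f] stays nonpositive just after [z],
    by continuity or by the sign of the derivative.  So [f <= 0] throughout; and
    [f b = 0] is excluded, since then [f > 0] just before [b]. *)
Lemma stays_negative (f df : R -> R) (a b : R) :
  (forall x, a <= x <= b -> is_derive f x (df x)) ->
  (forall x, a <= x <= b -> f x = 0 -> df x < 0) ->
  f a <= 0 -> a < b -> f b < 0.
Proof.
  intros Hd Hneg Ha Hab.
  assert (weak : forall b', a < b' <= b -> f b' <= 0).
  { intros b' Hb'.
    destruct (completeness (fun x => a <= x <= b' /\ f x <= 0)) as [z [Hub Hleast]].
    - exists b'. intros x [Hx _]. lra.
    - exists a. split; lra.
    - assert (Haz : a <= z) by (apply Hub; split; lra).
      assert (Hzb : z <= b') by (apply Hleast; intros x [Hx _]; lra).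
      assert (Hc : continuity_pt f z).
      { apply derivable_continuous_pt. exists (df z).
        apply is_derive_Reals, Hd. lra. }
      assert (Hfz : f z <= 0).
      { apply Rnot_lt_le. intros Hpos.
        destruct (proj1 (continuity_pt_locally f z) Hc (mkposreal _ Hpos)) as [delta Hdelta].
        assert (Hz' : z <= z - delta).
        { apply Hleast. intros x [Hx Hfx]. apply Rnot_lt_le. intros Hlt.
          assert (x <= z) by (apply Hub; split; assumption).
          assert (Hb : ball z delta x).
          { change (Rabs (x - z) < delta). apply Rabs_def1; destruct delta; simpl in *; lra. }
          specialize (Hdelta x Hb). simpl in Hdelta. apply Rabs_def2 in Hdelta. lra. }
        destruct delta; simpl in *; lra. }
      destruct (Rle_lt_or_eq_dec z b' Hzb) as [Hlt | <-]; [exfalso | exact Hfz].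
      assert (Hright : exists delta : posreal,
                 forall y, Rabs (y - z) < delta -> z < y -> f y <= 0).
      { destruct Hfz as [Hfz | Hfz].
        - destruct (proj1 (continuity_pt_locally f z) Hc (mkposreal (- f z) ltac:(lra)))
            as [delta Hdelta].
          exists delta. intros y Hy _. specialize (Hdelta y Hy).
          simpl in Hdelta. apply Rabs_def2 in Hdelta. lra.
        - destruct (derivative_neg_local_sign f z (df z)) as [delta Hdelta].
          + apply Hd; lra.
          + apply Hneg; lra.
          + exact Hfz.
          + exists delta. intros y Hy Hzy. apply Rlt_le, (Hdelta y Hy), Hzy. }
      destruct Hright as [delta Hright].
      set (y := z + Rmin (delta / 2) (b' - z)).
      assert (Hy : z < y <= b' /\ y <= z + delta / 2).
      { unfold y. pose proof (Rmin_l (delta / 2) (b' - z)).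
        pose proof (Rmin_r (delta / 2) (b' - z)).
        assert (0 < Rmin (delta / 2) (b' - z))
          by (apply Rmin_pos; destruct delta; simpl in *; lra).
        lra. }
      assert (y <= z); [ | lra].
      apply Hub. split; [lra |]. apply Hright; [ | lra].
      apply Rabs_def1; destruct delta; simpl in *; lra. }
  destruct (weak b ltac:(lra)) as [Hlt | Heq]; [exact Hlt | exfalso].
  destruct (derivative_neg_local_sign f b (df b)) as [delta Hdelta].
  - apply Hd; lra.
  - apply Hneg; lra.
  - exact Heq.
  - set (y := b - Rmin (delta / 2) ((b - a) / 2)).
    assert (Hy : a < y < b /\ b - delta / 2 <= y).
    { unfold y. pose proof (Rmin_l (delta / 2) ((b - a) / 2)).
      pose proof (Rmin_r (delta / 2) ((b - a) / 2)).
      assert (0 < Rmin (delta / 2) ((b - a) / 2))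
        by (apply Rmin_pos; destruct delta; simpl in *; lra).
      lra. }
    assert (Hpos : 0 < f y).
    { apply (Hdelta y); [ | lra].
      apply Rabs_def1; destruct delta; simpl in *; lra. }
    specialize (weak y ltac:(lra)). lra.
Qed.

(** * Continuity relative to a segment *)

Definition continuous_on_segment (f : R -> R) (a b : R) : Prop :=
  forall x, a <= x <= b -> forall eps : posreal, exists delta : posreal,
    forall y, a <= y <= b -> Rabs (y - x) < delta -> Rabs (f y - f x) < eps.

(** The intermediate value theorem for a function that may be arbitrary outside
    the segment: compose it with the projection of the line onto [[a, b]]. *)
Lemma zero_on_segment (f : R -> R) (a b : R) :
  a <= b -> continuous_on_segment f a b -> f a <= 0 <= f b ->
  exists z, a <= z <= b /\ f z = 0.
Proof.
  intros Hab Hc Hf.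
  set (clamp := fun t => Rmax a (Rmin b t)).
  assert (Hin : forall t, a <= clamp t <= b).
  { intros t. unfold clamp, Rmax, Rmin.
    repeat destruct Rle_dec; lra. }
  assert (Hid : forall t, a <= t <= b -> clamp t = t).
  { intros t Ht. unfold clamp, Rmax, Rmin. repeat destruct Rle_dec; lra. }
  assert (Hlip : forall t u, Rabs (clamp t - clamp u) <= Rabs (t - u)).
  { intros t u. unfold clamp, Rmax, Rmin.
    repeat destruct Rle_dec; unfold Rabs; repeat destruct Rcase_abs; lra. }
  destruct (IVT_gen (fun t => f (clamp t)) a b 0) as [z [_ Hz]].
  - intros t. apply continuity_pt_locally. intros eps.
    destruct (Hc (clamp t) (Hin t) eps) as [delta Hdelta].
    exists delta. intros y Hy. apply Hdelta; [apply Hin |].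
    eapply Rle_lt_trans; [apply Hlip | exact Hy].
  - rewrite !Hid by lra. rewrite Rmin_left, Rmax_right by lra. exact Hf.
  - exists (clamp z). split; [apply Hin | exact Hz].
Qed.

(** * Level curves in the plane *)

(** The total derivative of [G] along a level curve of [F], as in implicit
    differentiation.  Stated for all nearby points of the level set, it needs no
    differentiable parametrization of that set: where [F] is constant,
    [a dx + b dn] is of smaller order, so [dn = - a / b dx] up to that order. *)
Lemma slope_along_level_curve (F G : R -> R -> R) (x0 n0 a b c d : R) :
  b <> 0 ->
  differentiable_pt_lim F x0 n0 a b -> differentiable_pt_lim G x0 n0 c d ->
  forall eps : posreal, locally_2d (fun x n => F x n = F x0 n0 ->
    Rabs (G x n - G x0 n0 - (c - d * a / b) * (x - x0)) <= eps * Rabs (x - x0))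
    x0 n0.
Proof.
  intros Hb HF HG eps.
  assert (Hb' : 0 < Rabs b) by now apply Rabs_pos_lt.
  (* On the level curve [|dn| <= 2 |a / b| |dx|] near the base point, so
     [L |dx|] bounds the distance to it; [k] accounts for the multiple
     [d / b] of the first-order error of [F] that is added to that of [G]. *)
  set (L := 1 + 2 * Rabs a / Rabs b).
  set (k := 1 + Rabs (d / b)).
  assert (Hq : 0 <= Rabs a / Rabs b) by (apply Rdiv_le_0_compat; [apply Rabs_pos | exact Hb']).
  assert (HL : 1 <= L) by (unfold L; lra).
  assert (Hk : 1 <= k) by (unfold k; pose proof (Rabs_pos (d / b)); lra).
  assert (HkL : 0 < k * L) by nra.
  assert (He : 0 < Rmin (Rabs b / 2) (eps / (k * L))).
  { apply Rmin_pos; [lra |]. apply Rdiv_lt_0_compat; [apply cond_pos | exact HkL]. }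
  set (e := mkposreal _ He).
  assert (He1 : e <= Rabs b / 2) by apply Rmin_l.
  assert (He2 : e * (k * L) <= eps).
  { apply (Rmult_le_reg_r (/ (k * L))); [now apply Rinv_0_lt_compat |].
    rewrite Rmult_assoc, Rinv_r, Rmult_1_r by lra. apply Rmin_r. }
  clearbody e.
  generalize (HG e). apply locally_2d_impl. generalize (HF e). apply locally_2d_impl.
  apply locally_2d_forall. intros x n HFx HGx Heq.
  rewrite Heq in HFx.
  set (dx := x - x0) in *. set (dn := n - n0) in *.
  set (M := Rmax (Rabs dx) (Rabs dn)) in *.
  assert (Hlin : Rabs (a * dx + b * dn) <= e * M).
  { rewrite <- Rabs_Ropp. eapply Rle_trans; [ | exact HFx]. right. f_equal. ring. }
  assert (HM : M <= L * Rabs dx).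
  { pose proof (Rabs_pos dx) as Hdx. unfold M, Rmax in *.
    destruct Rle_dec as [Hle | Hgt]; [ | nra].
    assert (H1 : Rabs (b * dn) <= Rabs (a * dx + b * dn) + Rabs (a * dx)).
    { replace (b * dn) with ((a * dx + b * dn) - a * dx) at 1 by ring.
      eapply Rle_trans; [apply Rabs_triang |]. rewrite Rabs_Ropp. lra. }
    rewrite !Rabs_mult in H1.
    assert (H2 : Rabs b * Rabs dn <= 2 * (Rabs a * Rabs dx)).
    { pose proof (Rabs_pos dn). nra. }
    assert (H3 : Rabs dn <= 2 * Rabs a / Rabs b * Rabs dx).
    { apply (Rmult_le_reg_l (Rabs b)); [exact Hb' |].
      eapply Rle_trans; [exact H2 |]. right. field. lra. }
    unfold L. nra. }
  replace (G x n - G x0 n0 - (c - d * a / b) * dx)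
    with ((G x n - G x0 n0 - (c * dx + d * dn)) + d / b * (a * dx + b * dn))
    by (field; exact Hb).
  eapply Rle_trans; [apply Rabs_triang |]. rewrite Rabs_mult.
  assert (HkM : Rabs (d / b) * Rabs (a * dx + b * dn) <= Rabs (d / b) * (e * M)).
  { apply Rmult_le_compat_l; [apply Rabs_pos | exact Hlin]. }
  assert (0 <= e * k) by (pose proof (cond_pos e); nra).
  assert (e * k * M <= e * k * (L * Rabs dx)) by now apply Rmult_le_compat_l.
  pose proof (Rabs_pos dx). unfold k in *. nra.
Qed.

(** Continuity of one of the two partial derivatives is enough for
    differentiability. *)
Lemma differentiable_of_partials (f dfx dfn : R -> R -> R) :
  (forall x n, 0 < x -> 1 < n -> is_derive (fun t => f t n) x (dfx x n)) ->
  (forall x n, 0 < x -> 1 < n -> is_derive (fun m => f x m) n (dfn x n)) ->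
  continuous_sym dfx ->
  forall x n, 0 < x -> 1 < n ->
  differentiable_pt_lim f x n (dfx x n) (dfn x n).
Proof.
  intros Hx Hn Hc x n Hx0 Hn0.
  apply filterdiff_differentiable_pt_lim.
  apply (is_derive_filterdiff f x n dfx (dfn x n)).
  - apply (locally_2d_locally
             (fun u v => is_derive (fun z : R_AbsRing => f z v) u (dfx u v))).
    assert (Hd : 0 < Rmin x (n - 1)) by (apply Rmin_pos; lra).
    exists (mkposreal _ Hd). simpl. intros u v Hu Hv.
    apply Rabs_def2 in Hu. apply Rabs_def2 in Hv.
    pose proof (Rmin_l x (n - 1)). pose proof (Rmin_r x (n - 1)).
    apply Hx; lra.
  - now apply Hn.
  - now apply continuity_2d_pt_filterlim, Hc.
Qed.

(** At each [x] of [[a, b]], the crossings in the [x] direction make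
    [F x n0 >= 0] and [F x n1 <= 0], so a zero lies between [n0] and [n1], and
    the crossing in the [n] direction makes it unique.  For continuity, the
    signs of [F x (N x - e)] and [F x (N x + e)] persist for [y] near [x], and
    so keep [N y] between [N x - e] and [N x + e]. *)
Lemma decreasing_zero_curve (F : R -> R -> R) (lo a b n0 n1 : R) :
  (forall x n m, a <= x <= b -> lo < n -> F x n <= 0 -> n < m -> F x m < 0) ->
  (forall x y n, lo < n -> a <= x -> y <= b -> F x n <= 0 -> x < y -> F y n < 0) ->
  (forall x n, a <= x <= b -> lo < n -> continuity_2d_pt F x n) ->
  a <= b -> lo < n0 -> n0 <= n1 -> F a n1 = 0 -> F b n0 = 0 ->
  exists N : R -> R, continuous_on_segment N a b /\ N a = n1 /\ N b = n0 /\
    forall x, a <= x <= b -> lo < N x /\ F x (N x) = 0.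
Proof.
  intros Hn Hx Hc Hab Hlo H01 Ha Hb.
  assert (Hex : forall x, exists n, a <= x <= b -> n0 <= n <= n1 /\ F x n = 0).
  { intros x. destruct (Rle_dec a x) as [Hax | Hax]; [ | exists 0; lra].
    destruct (Rle_dec x b) as [Hxb | Hxb]; [ | exists 0; lra].
    assert (H0 : 0 <= F x n0).
    { apply Rnot_lt_le. intros Hneg. destruct Hxb as [Hxb | ->]; [ | lra].
      specialize (Hx x b n0 Hlo Hax). lra. }
    assert (H1 : F x n1 <= 0).
    { destruct Hax as [Hax | <-]; [ | lra].
      specialize (Hx a x n1). lra. }
    destruct (zero_on_segment (fun n => - F x n) n0 n1 H01) as [n [Hn01 Hz]].
    - intros n Hn01 eps.
      destruct (Hc x n ltac:(lra) ltac:(lra) eps) as [delta Hdelta].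
      exists delta. intros m _ Hm.
      replace (- F x m - - F x n) with (- (F x m - F x n)) by ring.
      rewrite Rabs_Ropp. apply Hdelta; [ | exact Hm].
      rewrite Rminus_eq_0, Rabs_R0. apply cond_pos.
    - lra.
    - exists n. intros _. split; lra. }
  destruct (functional_choice _ Hex) as [N HN].
  assert (Huniq : forall x n m, a <= x <= b -> lo < n -> lo < m ->
            F x n = 0 -> F x m = 0 -> n = m).
  { intros x n m Hxab Hnlo Hmlo Hzn Hzm.
    destruct (Rtotal_order n m) as [H | [H | H]]; [ | exact H | ].
    - specialize (Hn x n m). lra.
    - specialize (Hn x m n). lra. }
  exists N. split; [ | split; [ | split]].
  - intros x Hxab eps. destruct (HN x Hxab) as [HNx HFx].
    set (e := Rmin (eps / 2) ((N x - lo) / 2)).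
    pose proof (cond_pos eps) as Heps.
    assert (He : 0 < e) by (apply Rmin_pos; lra).
    assert (He1 : e <= eps / 2) by apply Rmin_l.
    assert (He2 : e <= (N x - lo) / 2) by apply Rmin_r.
    assert (Hup : F x (N x + e) < 0) by (apply (Hn x (N x)); lra).
    assert (Hdn : 0 < F x (N x - e)).
    { apply Rnot_le_lt. intros Hle. specialize (Hn x (N x - e) (N x)). lra. }
    destruct (Hc x (N x + e) Hxab ltac:(lra) (mkposreal (- F x (N x + e)) ltac:(lra)))
      as [d1 Hd1].
    destruct (Hc x (N x - e) Hxab ltac:(lra) (mkposreal _ Hdn)) as [d2 Hd2].
    assert (Hd : 0 < Rmin d1 d2) by (apply Rmin_pos; apply cond_pos).
    exists (mkposreal _ Hd). simpl. intros y Hyab Hy.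
    assert (H0 : forall m (d : posreal), Rabs (m - m) < d).
    { intros m d. rewrite Rminus_eq_0, Rabs_R0. apply cond_pos. }
    specialize (Hd1 y (N x + e) (Rlt_le_trans _ _ _ Hy (Rmin_l _ _)) (H0 _ _)).
    specialize (Hd2 y (N x - e) (Rlt_le_trans _ _ _ Hy (Rmin_r _ _)) (H0 _ _)).
    simpl in Hd1, Hd2. apply Rabs_def2 in Hd1. apply Rabs_def2 in Hd2.
    destruct (HN y Hyab) as [HNy HFy].
    assert (N y < N x + e).
    { apply Rnot_le_lt. intros [Hlt | Heq].
      - specialize (Hn y (N x + e) (N y)). lra.
      - rewrite Heq in Hd1. lra. }
    assert (N x - e < N y).
    { apply Rnot_le_lt. intros [Hlt | Heq].
      - specialize (Hn y (N y) (N x - e)). lra.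
      - rewrite <- Heq in Hd2. lra. }
    apply Rabs_def1; lra.
  - destruct (HN a ltac:(lra)). apply (Huniq a); lra.
  - destruct (HN b ltac:(lra)). apply (Huniq b); lra.
  - intros x Hxab. destruct (HN x Hxab). split; lra.
Qed.

Lemma continuous_along_graph (G : R -> R -> R) (N : R -> R) (a b : R) :
  (forall x, a <= x <= b -> continuity_2d_pt G x (N x)) ->
  continuous_on_segment N a b ->
  continuous_on_segment (fun x => G x (N x)) a b.
Proof.
  intros HG HN x Hx eps.
  destruct (HG x Hx eps) as [d1 Hd1]. destruct (HN x Hx d1) as [d2 Hd2].
  assert (Hd : 0 < Rmin d1 d2) by (apply Rmin_pos; apply cond_pos).
  exists (mkposreal _ Hd). simpl. intros y Hy Hyx. apply Hd1.
  - eapply Rlt_le_trans; [exact Hyx | apply Rmin_l].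
  - apply Hd2; [exact Hy |]. eapply Rlt_le_trans; [exact Hyx | apply Rmin_r].
Qed.

(** Since [G] decreases through zero at [b] along the curve, it is positive just
    before [b]; as it is negative at [a], it has a zero in between. *)
Lemma zero_before_downcrossing (F G : R -> R -> R) (N : R -> R)
  (a b dFx dFn dGx dGn : R) :
  a < b -> continuous_on_segment N a b ->
  (forall x, a <= x <= b -> F x (N x) = 0) ->
  (forall x, a <= x <= b -> continuity_2d_pt G x (N x)) ->
  differentiable_pt_lim F b (N b) dFx dFn ->
  differentiable_pt_lim G b (N b) dGx dGn ->
  dFn <> 0 -> dGx - dGn * dFx / dFn < 0 ->
  G a (N a) < 0 -> G b (N b) = 0 ->
  exists x, a <= x < b /\ G x (N x) = 0.
Proof.
  intros Hab HN HF HG dF dG Hne Hslope Ha Hb.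
  set (r := dGx - dGn * dFx / dFn) in *.
  (* An error of [- r / 2] per unit of [b - x] leaves at least half of the
     rise [- r (b - x)]. *)
  destruct (slope_along_level_curve F G b (N b) dFx dFn dGx dGn Hne dF dG
              (mkposreal (- r / 2) ltac:(lra))) as [d1 Hd1].
  destruct (HN b ltac:(lra) d1) as [d2 Hd2].
  set (h := Rmin (b - a) (Rmin d1 d2 / 2)).
  assert (Hd : 0 < Rmin d1 d2) by (apply Rmin_pos; apply cond_pos).
  assert (Hh : 0 < h) by (apply Rmin_pos; lra).
  assert (Hh1 : h <= b - a) by apply Rmin_l.
  assert (Hh2 : h <= Rmin d1 d2 / 2) by apply Rmin_r.
  pose proof (Rmin_l d1 d2). pose proof (Rmin_r d1 d2).
  assert (Habs : Rabs (b - h - b) = h).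
  { replace (b - h - b) with (- h) by ring. rewrite Rabs_Ropp, Rabs_pos_eq; lra. }
  assert (Hpos : 0 < G (b - h) (N (b - h))).
  { specialize (Hd1 (b - h) (N (b - h))). simpl in Hd1. fold r in Hd1.
    rewrite Habs, Hb, !HF in Hd1 by lra.
    specialize (Hd1 ltac:(lra) ltac:(apply Hd2; [lra | rewrite Habs; lra]) eq_refl).
    apply Rabs_le_between in Hd1. nra. }
  destruct (zero_on_segment (fun x => G x (N x)) a (b - h)) as [z [Hz Hz0]].
  - lra.
  - apply continuous_along_graph.
    + intros x Hx. apply HG. lra.
    + intros x Hx eps. destruct (HN x ltac:(lra) eps) as [d Hd'].
      exists d. intros y Hy. apply Hd'. lra.
  - lra.
  - exists z. split; [lra | exact Hz0].
Qed.

(** * Profit and static marginal profit as functions of output and firms *)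

(** By definition [free_entry P c x n] is [profit P c x n = 0]. *)
Definition profit (P : demand) (c : R -> R) (x n : R) : R :=
  price P x n * x - c x.

Section Model.

Context (P : demand) (c : R -> R).
Hypothesis (hP : smooth_demand P) (hE : entry_convention P) (hc : smooth_cost c).

Lemma is_derive_profit_x x n : 0 < x -> 1 < n ->
  is_derive (fun t => profit P c t n) x (industry_marginal P c x n).
Proof.
  intros Hx Hn. unfold profit, industry_marginal, cost1.
  pose proof (price_x P hE x n Hx Hn) as Hp.
  pose proof (Derive_correct _ _ (derivable_c c hc x Hx)) as Hc.
  change (AbsRing.sort R_AbsRing) with R in *.
  auto_derive.
  - repeat split; [eexists; exact Hp | eexists; exact Hc].
  - rewrite (is_derive_unique _ _ _ Hp).
    change (fun t : R => c t) with c. ring.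
Qed.

Lemma is_derive_profit_n x n : 0 < x -> 1 < n ->
  is_derive (fun m => profit P c x m) n (p2 P x n * x ^ 2).
Proof.
  intros Hx Hn. unfold profit.
  pose proof (price_n P hE x n Hx Hn) as Hp.
  change (AbsRing.sort R_AbsRing) with R in *.
  auto_derive.
  - eexists; exact Hp.
  - rewrite (is_derive_unique _ _ _ Hp). ring.
Qed.

Definition static_marginal_dx (x n : R) : R :=
  2 * p1 P x n + p11 P x n * x - cost2 c x
  + (n - 1) * (p2 P x n + p12 P x n * x).

Definition static_marginal_dn (x n : R) : R :=
  x * (p2 P x n + p12 P x n * x).

Lemma is_derive_static_marginal_x x n : 0 < x -> 1 < n ->
  is_derive (fun t => static_marginal P c t n) x (static_marginal_dx x n).
Proof.
  intros Hx Hn. unfold static_marginal, static_marginal_dx, cost2.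
  pose proof (price_x P hE x n Hx Hn) as Hp.
  pose proof (p1_x P hE x n Hx Hn) as Hp1.
  pose proof (Derive_correct _ _ (derivable_c1 c hc x Hx)) as Hc.
  unfold cost1 in *.
  change (AbsRing.sort R_AbsRing) with R in *.
  auto_derive.
  - repeat split; [eexists; exact Hp | eexists; exact Hp1 | eexists; exact Hc].
  - rewrite (is_derive_unique _ _ _ Hp), (is_derive_unique _ _ _ Hp1).
    change (fun t : R => Derive c t) with (Derive c). ring.
Qed.

Lemma is_derive_static_marginal_n x n : 0 < x -> 1 < n ->
  is_derive (fun m => static_marginal P c x m) n (static_marginal_dn x n).
Proof.
  intros Hx Hn. unfold static_marginal, static_marginal_dn.
  pose proof (price_n P hE x n Hx Hn) as Hp.
  pose proof (p1_n P hE x n Hx Hn) as Hp1.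
  change (AbsRing.sort R_AbsRing) with R in *.
  auto_derive.
  - repeat split; [eexists; exact Hp | eexists; exact Hp1].
  - rewrite (is_derive_unique _ _ _ Hp), (is_derive_unique _ _ _ Hp1). ring.
Qed.

Lemma continuous_sym_of_x (f : R -> R) :
  (forall x, 0 < x -> continuous f x) -> continuous_sym (fun x _ => f x).
Proof.
  intros Hf x n Hx _. apply (continuity_1d_2d_pt_comp f (fun u _ => u)).
  - now apply continuity_pt_filterlim, Hf.
  - apply continuity_2d_pt_id1.
Qed.

Lemma continuous_cost1 : continuous_sym (fun x _ => cost1 c x).
Proof.
  apply continuous_sym_of_x. intros x Hx.
  apply (@ex_derive_continuous R_AbsRing R_NormedModule), (derivable_c1 c hc x Hx).
Qed.

Ltac continuous_2d :=
  repeat first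
    [ apply continuity_2d_pt_minus | apply continuity_2d_pt_plus
    | apply continuity_2d_pt_mult | apply continuity_2d_pt_const
    | apply continuity_2d_pt_id1 | apply continuity_2d_pt_id2
    | now apply (cont_price P hP) | now apply (cont_p1 P hP)
    | now apply (cont_p2 P hP) | now apply (cont_p11 P hP)
    | now apply (cont_p12 P hP) | now apply continuous_cost1
    | now apply (continuous_sym_of_x (cost2 c) (cont_c2 c hc)) ].

Lemma differentiable_profit x n : 0 < x -> 1 < n ->
  differentiable_pt_lim (profit P c) x n
    (industry_marginal P c x n) (p2 P x n * x ^ 2).
Proof.
  apply (differentiable_of_partials (profit P c) (industry_marginal P c)
           (fun x n => p2 P x n * x ^ 2)).
  - exact is_derive_profit_x.
  - exact is_derive_profit_n.
  - intros x' n' Hx Hn. unfold industry_marginal. continuous_2d.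
Qed.

Lemma differentiable_static_marginal x n : 0 < x -> 1 < n ->
  differentiable_pt_lim (static_marginal P c) x n
    (static_marginal_dx x n) (static_marginal_dn x n).
Proof.
  apply differentiable_of_partials.
  - exact is_derive_static_marginal_x.
  - exact is_derive_static_marginal_n.
  - intros x' n' Hx Hn. unfold static_marginal_dx. continuous_2d.
Qed.

(** At a static equilibrium [industry_marginal = (n - 1) p2 x], so the locus has
    slope [dn/dx = - (n - 1) / x]: the firms that leave take away as much rival
    output as the remaining [n - 1] rivals add.  The terms in [p2 + p12 x]
    therefore cancel. *)
Lemma static_marginal_slope_on_locus x n : 0 < x -> p2 P x n <> 0 ->
  static_marginal P c x n = 0 ->
  static_marginal_dx x n
  - static_marginal_dn x n * industry_marginal P c x n / (p2 P x n * x ^ 2)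
  = 2 * p1 P x n + p11 P x n * x - cost2 c x.
Proof.
  intros Hx Hp2 Hfoc.
  replace (industry_marginal P c x n) with ((n - 1) * p2 P x n * x)
    by (unfold industry_marginal, static_marginal in *; lra).
  unfold static_marginal_dx, static_marginal_dn. field. split; lra.
Qed.

(** * The free entry locus *)

Section Locus.

Variables xl xu : R.
Hypothesis hxl : 0 < xl.
Hypothesis hp2 : forall x n, xl <= x <= xu -> 1 < n ->
  free_entry P c x n -> p2 P x n < 0.
Hypothesis hlocus : forall x n, xl <= x <= xu -> 1 < n ->
  free_entry P c x n -> industry_marginal P c x n < 0.

Lemma profit_single_crossing_n x n m : xl <= x <= xu -> 1 < n ->
  profit P c x n <= 0 -> n < m -> profit P c x m < 0.
Proof.
  intros Hx Hn. apply (stays_negative _ (fun k => p2 P x k * x ^ 2)).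
  - intros k Hk. apply is_derive_profit_n; lra.
  - intros k Hk H0. specialize (hp2 x k ltac:(lra) ltac:(lra) H0).
    assert (0 < x ^ 2) by (apply pow_lt; lra). nra.
Qed.

Lemma profit_single_crossing_x x y n : 1 < n -> xl <= x -> y <= xu ->
  profit P c x n <= 0 -> x < y -> profit P c y n < 0.
Proof.
  intros Hn Hx Hy.
  apply (stays_negative (fun t => profit P c t n) (fun t => industry_marginal P c t n)).
  - intros t Ht. apply is_derive_profit_x; lra.
  - intros t Ht H0. apply hlocus; [lra | lra | exact H0].
Qed.

(** If [x0 <= x1], go from [(x0, n0)] to [(x1, n0)] and on to [(x1, n1)].
    Profit starts at zero and is negative after the first step of positive
    length, so it cannot be zero again at the end unless the points coincide. *)
Lemma more_firms_less_output x0 n0 x1 n1 :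
  xl <= x0 <= xu -> xl <= x1 <= xu -> 1 < n0 ->
  free_entry P c x0 n0 -> free_entry P c x1 n1 ->
  n0 <= n1 -> (x0, n0) <> (x1, n1) -> x1 < x0.
Proof.
  change (free_entry P c) with (fun x n => profit P c x n = 0). cbv beta.
  intros Hx0 Hx1 Hn0 H0 H1 Hle Hne. apply Rnot_le_lt. intros Hx.
  assert (Hneg : profit P c x1 n0 <= 0).
  { destruct Hx as [Hx | <-]; [ | lra].
    apply Rlt_le, (profit_single_crossing_x x0); lra. }
  destruct Hle as [Hlt | <-].
  - pose proof (profit_single_crossing_n x1 n0 n1). lra.
  - destruct Hx as [Hx | <-]; [ | now apply Hne].
    pose proof (profit_single_crossing_x x0 x1 n0). lra.
Qed.

Lemma static_equilibrium_between xt nt x1 n1 :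
  xl <= x1 -> xt <= xu ->
  static_equilibrium P c xt nt -> static_soc P c xt nt ->
  free_entry P c x1 n1 -> static_marginal P c x1 n1 < 0 ->
  nt <= n1 -> x1 < xt ->
  exists x n, static_equilibrium P c x n /\ x < xt.
Proof.
  intros Hx1 Hxt [Hxt0 Hnt Het Hft] Hsoc H1 Hneg Hle Hlt.
  assert (HdG : forall x n, xl <= x -> 1 < n ->
            continuity_2d_pt (static_marginal P c) x n).
  { intros x n Hx Hn. apply differentiable_continuity_pt.
    do 2 eexists. apply differentiable_static_marginal; lra. }
  destruct (decreasing_zero_curve (profit P c) 1 x1 xt nt n1)
    as [N [HN [HN1 [HNt HNz]]]]; try assumption.
  - intros x n m Hx. apply profit_single_crossing_n. lra.
  - intros x y n Hn Hx Hy. apply profit_single_crossing_x; lra.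
  - intros x n Hx Hn. apply differentiable_continuity_pt.
    do 2 eexists. apply differentiable_profit; lra.
  - lra.
  - assert (Hp2 : p2 P xt nt < 0) by (apply hp2; [lra | exact Hnt | exact Het]).
    assert (0 < xt ^ 2) by (apply pow_lt; lra).
    destruct (zero_before_downcrossing (profit P c) (static_marginal P c) N x1 xt
                (industry_marginal P c xt nt) (p2 P xt nt * xt ^ 2)
                (static_marginal_dx xt nt) (static_marginal_dn xt nt))
      as [z [Hz Hz0]].
    + exact Hlt.
    + exact HN.
    + intros x Hx. now apply HNz.
    + intros x Hx. destruct (HNz x Hx). apply HdG; lra.
    + rewrite HNt. now apply differentiable_profit.
    + rewrite HNt. now apply differentiable_static_marginal.
    + nra.
    + rewrite static_marginal_slope_on_locus by (assumption || lra). exact Hsoc.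
    + now rewrite HN1.
    + now rewrite HNt.
    + exists z, (N z). destruct (HNz z ltac:(lra)) as [HNz1 HNz2].
      split; [ | lra]. constructor; [lra | exact HNz1 | exact HNz2 | exact Hz0].
Qed.

End Locus.
End Model.

(** * The open-loop steady state *)

(** The adjoint condition reads [rho lam = p2 x^2 (1 + lam n s)]: for
    [lam >= 0] the right side would be negative and the left side not. *)
Lemma open_loop_costate_neg (P : demand) (c : R -> R) (s rho x n lam : R) :
  0 < s -> 0 < rho -> p2 P x n < 0 ->
  open_loop_steady_state P c s rho x n lam -> lam < 0.
Proof.
  intros Hs Hrho Hp2 [Hx Hn _ _ Hadj _].
  apply Rnot_le_lt. intros Hlam.
  assert (Hq : 0 < - p2 P x n * x ^ 2).
  { apply Rmult_lt_0_compat; [lra | now apply pow_lt]. }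
  assert (0 <= lam * n * s) by (apply Rmult_le_pos; [apply Rmult_le_pos | ]; lra).
  assert (0 <= rho * lam) by nra.
  nra.
Qed.

Theorem proposition1
  (P : demand) (c : R -> R) (s rho : R)
  (xl xu : R) (xt nt : R) (xs ns lams : R)
  (hs : 0 < s) (hrho : 0 < rho)
  (hPsmooth : smooth_demand P)
  (hPsym : symmetric_demand P)
  (hPentry : entry_convention P)
  (hcsmooth : smooth_cost c)
  (hc1 : forall x, 0 < x -> cost1 c x > 0)
  (hxl : 0 < xl)
  (hxt : xl <= xt <= xu)
  (hxs : xl <= xs <= xu)
  (hstanding : forall x n, xl <= x <= xu -> 1 < n ->
     free_entry P c x n -> standing P c x n)
  (hlocus : forall x n, xl <= x <= xu -> 1 < n ->
     free_entry P c x n -> industry_marginal P c x n < 0)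
  (hstatic : static_equilibrium P c xt nt)
  (hstatic_soc : static_soc P c xt nt)
  (hstatic_unique : forall x n,
     static_equilibrium P c x n -> x = xt /\ n = nt)
  (hsteady : open_loop_steady_state P c s rho xs ns lams)
  (hsteady_unique : forall x n lam,
     open_loop_steady_state P c s rho x n lam ->
     x = xs /\ n = ns /\ lam = lams)
  (hdyn : dynamic_condition P c xs ns) :
  ns < nt.
Proof.
  assert (hp2 : forall x n, xl <= x <= xu -> 1 < n ->
            free_entry P c x n -> p2 P x n < 0).
  { intros x n Hx Hn H0. exact (p2_neg _ _ _ _ (hstanding x n Hx Hn H0)). }
  pose proof (ol_n _ _ _ _ _ _ _ hsteady) as Hns.
  pose proof (ol_entry _ _ _ _ _ _ _ hsteady) as Hes.
  pose proof (ol_foc _ _ _ _ _ _ _ hsteady) as Hfoc.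
  pose proof (open_loop_costate_neg P c s rho xs ns lams hs hrho
                (hp2 xs ns hxs Hns Hes) hsteady) as Hlam.
  pose proof (hlocus xs ns hxs Hns Hes) as Hind.
  assert (Hneg : static_marginal P c xs ns < 0).
  { assert (0 < lams * s * industry_marginal P c xs ns); [ | lra].
    assert (lams * s < 0) by nra. nra. }
  apply Rnot_le_lt. intros Hle.
  assert (Hlt : xs < xt).
  { apply (more_firms_less_output P c hPentry hcsmooth xl xu hxl hp2 hlocus
             xt nt xs ns); try assumption; try apply hstatic.
    intros [= -> ->]. rewrite (se_foc _ _ _ _ hstatic) in Hneg. lra. }
  destruct (static_equilibrium_between P c hPsmooth hPentry hcsmooth
              xl xu hxl hp2 hlocus xt nt xs ns)
    as [x [n [Hse Hx]]]; try assumption; try lra.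
  destruct (hstatic_unique x n Hse). lra.
Qed.
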